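(* Let $(L,\otimes,u)$ be a commutative unital quantale and let $(X,\langle\cdot\rangle)$ be an $L$-closure space. Then $(\mathfrak{C}(X),\mathrm{sub})$ is an algebraic $L$-dcpo.
   Context: Quantale: $(L,\otimes,u)$ is a complete lattice with bottom $0$ and top $1$, with an associative commutative operation $\otimes$ with unit $u$, distributing over arbitrary joins; $\to$ is its residuation, i.e. $a\otimes b\le c\iff a\le b\to c$. An $L$-subset of $X$ is a map $A:X\to L$; $L^X$ is ordered pointwise. For $x\in X$, $u_x\in L^X$ is given by $u_x(x)=u$ and $u_x(y)=0$ for $y\ne x$. $\mathrm{sub}(A,B)=\bigwedge_{x\in X}(A(x)\to B(x))$ for $A,B\in L^X$. $L$-orders: an $L$-ordered set is a set $P$ with $e:P\times P\to L$ such that $e(x,x)\ge u$; $e(x,y)\otimes e(y,z)\le e(x,z)$; and $e(x,y)\wedge e(y,x)\ge u$ implies $x=y$. Any subset of $L^X$ is an $L$-ordered set under $\mathrm{sub}$. An element $x_0$ is the supremum $\sqcup A$ of $A\in L^P$ if $e(x_0,y)=\bigwedge_{x\in P}(A(x)\to e(x,y))$ for all $y\in P$. $D\in L^P$ is directed if $\bigvee_{x\in P}D(x)\ge u$ and $D(x)\otimes D(y)\le\bigvee_{z\in P}D(z)\otimes e(x,z)\otimes e(y,z)$ for all $x,y$. $D\in L^P$ is a lower set if $D(x)\otimes e(y,x)\le D(y)$ for all $x,y$; an ideal is a directed lower set; $\mathcal{I}_L(P)$ is the set of ideals. $P$ is an $L$-dcpo if every directed $L$-subset has a supremum. For an $L$-dcpo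 $P$ and $x\in P$, define $\Downarrow x\in L^P$ by $\Downarrow x(y)=\bigwedge_{I\in\mathcal{I}_L(P)}(e(x,\sqcup I)\to I(y))$. An element $x$ of an $L$-dcpo $P$ is compact if $\Downarrow x(x)\ge u$; $K(P)$ is the set of compact elements. Define $k(x)\in L^P$ by $k(x)(y)=e(y,x)$ for $y\in K(P)$ and $k(x)(y)=0$ otherwise. $P$ is an algebraic $L$-dcpo if for every $x\in P$, $k(x)$ is directed and $\sqcup k(x)=x$. Closure spaces: an $L$-closure space $(X,\langle\cdot\rangle)$ is a set $X$ with $\langle\cdot\rangle:L^X\to L^X$ such that for all $A,B\in L^X$: $A\le\langle A\rangle$; $\mathrm{sub}(A,B)\le\mathrm{sub}(\langle A\rangle,\langle B\rangle)$; $\langle\langle A\rangle\rangle=\langle A\rangle$. A directed closed set of $(X,\langle\cdot\rangle)$ is $U\in L^X$ such that for all $x,y\in X$: (DC1) $\bigvee_{x\in X}U(x)\ge u$; (DC2) $U(x)\le\mathrm{sub}(\langle u_x\rangle,U)$; (DC3) $U(x)\le\bigvee_{y\in X}U(y)\otimes\langle u_y\rangle(x)$; (DC4) $U(x)\otimes U(y)\le\bigvee_{z\in X}U(z)\otimes\langle u_z\rangle(x)\otimes\langle u_z\rangle(y)$. $\mathfrak{C}(X)$ is the set of all directed closed sets. *)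

(* Defs.v *)
From HB Require Import structures.
From mathcomp Require Import all_boot all_order.
From mathcomp Require Import boolp classical_sets.

Set Implicit Arguments.
Unset Strict Implicit.
Unset Printing Implicit Defensive.

Import Order.TTheory.
Local Open Scope classical_set_scope.
Local Open Scope order_scope.

HB.mixin Record TBLattice_isComplete d (L : Type) of Order.TBLattice d L := {
  bigjoin : set L -> L;
  bigmeet : set L -> L;
  bigjoin_supremums : forall A : set L, supremums A (bigjoin A);
  bigmeet_infimums : forall A : set L, infimums A (bigmeet A)
}.

#[short(type="completeLatticeType")]
HB.structure Definition CompleteLattice d :=
  {L of TBLattice_isComplete d L & Order.TBLattice d L}.

Notation "\bigvee_ ( x : T ) F" := (bigjoin (range (fun x : T => F)))
  (at level 41, x name, T at level 200, F at level 60,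
   format "'[' \bigvee_ ( x  :  T ) '/  '  F ']'") : order_scope.
Notation "\bigwedge_ ( x : T ) F" := (bigmeet (range (fun x : T => F)))
  (at level 41, x name, T at level 200, F at level 60,
   format "'[' \bigwedge_ ( x  :  T ) '/  '  F ']'") : order_scope.

Reserved Notation "a ⊗ b" (at level 40, left associativity).
Reserved Notation "a ⇒ b" (at level 55, right associativity).

HB.mixin Record CompleteLattice_isQuantale d (L : Type)
    of CompleteLattice d L := {
  tensor : L -> L -> L;
  qunit : L;
  tensorA : associative tensor;
  tensorC : commutative tensor;
  tensor1q : left_id qunit tensor;
  tensor_bigjoin : forall (a : L) (B : set L),
    tensor a (bigjoin B) = bigjoin (tensor a @` B)
}.

#[short(type="quantaleType")]
HB.structure Definition Quantale d :=
  {L of CompleteLattice_isQuantale d L & CompleteLattice d L}.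

Notation "a ⊗ b" := (tensor a b) : order_scope.

Definition residuum d (L : quantaleType d) (b c : L) : L :=
  bigjoin [set a : L | a ⊗ b <= c].
Notation "a ⇒ b" := (residuum a b) : order_scope.

Lemma residuumP d (L : quantaleType d) (a b c : L) :
  (a ⊗ b <= c) <-> (a <= b ⇒ c).
Proof.
have [ub lub] := bigjoin_supremums [set a : L | a ⊗ b <= c].
split=> [abc|abc]; first exact: ub.
have mono (x y z : L) : y <= z -> x ⊗ y <= x ⊗ z.
  move=> yz; have zE : z = bigjoin [set y; z].
    have [ub2 lub2] := bigjoin_supremums [set y; z].
    apply/eqP; rewrite eq_le; apply/andP; split.
      by apply: ub2; right.
    by apply: lub2 => w [->|->].
  rewrite [in leRHS]zE tensor_bigjoin.
  by have [+ _] := bigjoin_supremums (tensor x @` [set y; z]);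
    apply; exists y => //; left.
rewrite tensorC; apply: le_trans (mono b _ _ abc) _.
rewrite /residuum tensor_bigjoin.
have [_] := bigjoin_supremums (tensor b @` [set a : L | a ⊗ b <= c]).
by apply=> _ [x xbc <-]; rewrite tensorC.
Qed.

Section LSubsets.
Context {d : Order.disp_t} {L : quantaleType d} {X : Type}.

Definition sub (A B : X -> L) : L := \bigwedge_(x : X) (A x ⇒ B x).

Definition usingle (x : X) : X -> L :=
  fun y => if `[< y = x >] then qunit else \bot.

End LSubsets.

Section LOrders.
Context {d : Order.disp_t} {L : quantaleType d} {P : Type}.
Variable e : P -> P -> L.
Implicit Types (A D I : P -> L) (x y z : P).

Definition is_Lorder : Prop :=
  [/\ forall x, qunit <= e x x,
      forall x y z, e x y ⊗ e y z <= e x z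
    & forall x y, qunit <= e x y `&` e y x -> x = y].

Definition is_Lsup A (s : P) : Prop :=
  forall y, e s y = \bigwedge_(x : P) (A x ⇒ e x y).

Lemma is_Lsup_unique A (s t : P) :
  is_Lorder -> is_Lsup A s -> is_Lsup A t -> s = t.
Proof.
move=> [refl _ anti] sA tA; apply: anti.
by rewrite sA -tA [e t s]tA -sA lexI !refl.
Qed.

Definition is_directed D : Prop :=
  qunit <= \bigvee_(x : P) D x /\
  forall x y, D x ⊗ D y <= \bigvee_(z : P) (D z ⊗ e x z ⊗ e y z).

Definition is_lower A : Prop := forall x y, A x ⊗ e y x <= A y.

Definition is_ideal I : Prop := is_directed I /\ is_lower I.

Definition is_Ldcpo : Prop :=
  is_Lorder /\ forall D, is_directed D -> exists s, is_Lsup D s.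

(* The meet ranges over the ideals I, with s the supremum of I: in an L-dcpo
   it exists, and it is unique by [is_Lsup_unique]. *)
Definition waybelow x : P -> L := fun y =>
  bigmeet [set a : L | exists I s,
    [/\ is_ideal I, is_Lsup I s & a = (e x s ⇒ I y)]].

Definition is_compact x : Prop := qunit <= waybelow x x.

Definition compact_below x : P -> L := fun y =>
  if `[< is_compact y >] then e y x else \bot.

Definition is_algebraic_Ldcpo : Prop :=
  is_Ldcpo /\
  forall x, is_directed (compact_below x) /\ is_Lsup (compact_below x) x.

End LOrders.

Record Lclosure d (L : quantaleType d) (X : Type) := MkLclosure {
  Lclosure_op :> (X -> L) -> (X -> L);
  Lclosure_ext : forall (A : X -> L) x, A x <= Lclosure_op A x;
  Lclosure_sub : forall A B : X -> L,
    sub A B <= sub (Lclosure_op A) (Lclosure_op B);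
  Lclosure_idem : forall A : X -> L,
    Lclosure_op (Lclosure_op A) = Lclosure_op A
}.

Section DirectedClosed.
Context {d : Order.disp_t} {L : quantaleType d} {X : Type}.
Variable cl : Lclosure L X.

Definition is_directed_closed (U : X -> L) : Prop :=
  [/\ qunit <= \bigvee_(x : X) U x,
      forall x, U x <= sub (cl (usingle x)) U,
      forall x, U x <= \bigvee_(y : X) (U y ⊗ cl (usingle y) x)
    & forall x y, U x ⊗ U y <=
        \bigvee_(z : X) (U z ⊗ cl (usingle z) x ⊗ cl (usingle z) y)].

Definition directed_closed : Type := {U : X -> L | is_directed_closed U}.

Definition dc_sub (U V : directed_closed) : L := sub (sval U) (sval V).

End DirectedClosed.

(* Main.v *)
Require Import Defs.
From mathcomp Require Import all_boot all_order.
From mathcomp Require Import boolp classical_sets.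

(** Write [c x y] for [cl (usingle x) y].  The closure axioms make [c] a
    reflexive and transitive [L]-relation, so that [y, x |-> c x y] is an
    [L]-preorder on [X]; (DC2) says that [U] is a lower set for it, (DC1) and
    (DC4) say that [U] is directed, and reflexivity yields (DC3).
    Hence the directed closed sets are exactly the ideals of an [L]-preorder,
    and the theorem is the statement that an ideal completion is algebraic, the
    closures [c x] of points playing the part of the principal ideals.

    Suprema are computed pointwise: the supremum of a directed [D] is the union
    [y |-> \bigvee_V (D V ⊗ V y)] ([is_Lsup_union], [dc_union_closed]).
    The Yoneda identity [sub (c x) U = U x] ([principal_yoneda]) turns
    membership in such a union into membership in [D], which makes every [c x]
    compact ([principal_compact]).

    For algebraicity, let [approx U V = \bigvee_x (U x ⊗ sub V (c x))], the
    degree to which [V] lies below a principal ideal generated in [U].  Every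
    [L]-subset [D] that is bounded by [approx U] and contains each [c x] at
    least to the degree [U x] is directed with supremum [U]
    ([between_directed], [between_sup]).  This is used twice.  It applies to
    [approx U] itself, an ideal with supremum [U]; testing the compactness of
    [V] against this ideal gives [sub V U <= approx U V].  Therefore it also
    applies to [compact_below U], which is the claim. *)

Set Implicit Arguments.
Unset Strict Implicit.
Unset Printing Implicit Defensive.

Import Order.TTheory.
Local Open Scope classical_set_scope.
Local Open Scope order_scope.

(** * Joins, meets and the tensor of a quantale *)

Section QuantaleTheory.
Context {d : Order.disp_t} {L : quantaleType d}.
Implicit Types (a b c : L).

Lemma bigjoin_ub T (F : T -> L) x a : a <= F x -> a <= \bigvee_(x : T) F x.
Proof.
move=> /le_trans; apply.
by have [+ _] := bigjoin_supremums (range F); apply; exists x.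
Qed.

Lemma bigjoin_le T (F : T -> L) b :
  (forall x, F x <= b) -> \bigvee_(x : T) F x <= b.
Proof.
move=> Fb; have [_] := bigjoin_supremums (range F).
by apply=> _ [x _ <-].
Qed.

Lemma le_bigmeet (A : set L) b : (forall a, A a -> b <= a) -> b <= bigmeet A.
Proof. by move=> bA; have [_] := bigmeet_infimums A; apply=> a /bA. Qed.

Lemma bigmeet_lb (A : set L) a : A a -> bigmeet A <= a.
Proof. by move=> Aa; have [+ _] := bigmeet_infimums A; apply. Qed.

Lemma le_bigmeetP T (F : T -> L) b :
  (b <= \bigwedge_(x : T) F x) <-> (forall x, b <= F x).
Proof.
split=> [bF x|bF]; last by apply: le_bigmeet => _ [x _ <-].
by apply: le_trans bF _; apply: bigmeet_lb; exists x.
Qed.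

Lemma tensorq1 a : a ⊗ qunit = a.
Proof. by rewrite tensorC tensor1q. Qed.

Lemma tensor_le2l a b c : a <= b -> a ⊗ c <= b ⊗ c.
Proof. by move=> ab; apply/residuumP; apply: le_trans ab _; apply/residuumP. Qed.

Lemma tensor_le2 a a' b b' : a <= a' -> b <= b' -> a ⊗ b <= a' ⊗ b'.
Proof.
move=> aa' bb'; apply: le_trans (tensor_le2l _ aa') _.
by rewrite ![a' ⊗ _]tensorC; apply: tensor_le2l.
Qed.

Lemma le_tensorl a b : qunit <= b -> a <= b ⊗ a.
Proof. by move=> ub; rewrite -[leLHS]tensor1q; apply: tensor_le2l. Qed.

Lemma le_tensorr a b : qunit <= b -> a <= a ⊗ b.
Proof. by rewrite tensorC; apply: le_tensorl. Qed.

Lemma tensorAC a b c : a ⊗ b ⊗ c = a ⊗ c ⊗ b.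
Proof. by rewrite -!tensorA [b ⊗ c]tensorC. Qed.

Lemma tensorACA a b c (e : L) : (a ⊗ b) ⊗ (c ⊗ e) = (a ⊗ c) ⊗ (b ⊗ e).
Proof. by rewrite !tensorA [a ⊗ b ⊗ c]tensorAC. Qed.

Lemma bigjoin_tensor_le T (F : T -> L) a b :
  (forall x, F x ⊗ a <= b) -> (\bigvee_(x : T) F x) ⊗ a <= b.
Proof.
by move=> Fab; apply/residuumP; apply: bigjoin_le => x; apply/residuumP.
Qed.

Lemma bigjoin_tensor2_le S T (F : S -> L) (G : T -> L) b :
  (forall x y, F x ⊗ G y <= b) ->
  (\bigvee_(x : S) F x) ⊗ (\bigvee_(y : T) G y) <= b.
Proof.
move=> FGb; apply: bigjoin_tensor_le => x; rewrite tensorC.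
by apply: bigjoin_tensor_le => y; rewrite tensorC.
Qed.

End QuantaleTheory.

Section SubTheory.
Context {d : Order.disp_t} {L : quantaleType d} {X : Type}.
Implicit Types (A B C : X -> L) (a : L).

Lemma le_subP A B a : (a <= sub A B) <-> (forall x, a ⊗ A x <= B x).
Proof.
split=> [/le_bigmeetP aAB x|aAB]; first exact/residuumP.
by apply/le_bigmeetP => x; apply/residuumP.
Qed.

Lemma sub_tensor A B x : sub A B ⊗ A x <= B x.
Proof. by move: x; apply/le_subP. Qed.

Lemma sub_refl A : qunit <= sub A A.
Proof. by apply/le_subP => x; rewrite tensor1q. Qed.

Lemma sub_trans A B C : sub A B ⊗ sub B C <= sub A C.
Proof.
apply/le_subP => x; rewrite tensorAC.
apply: le_trans (tensor_le2l _ (sub_tensor A B x)) _.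
by rewrite tensorC; apply: sub_tensor.
Qed.

Lemma sub_anti A B : qunit <= sub A B -> qunit <= sub B A -> A = B.
Proof.
move=> /le_subP AB /le_subP BA; apply/funext => x; apply/le_anti.
by have := AB x; have := BA x; rewrite !tensor1q => -> ->.
Qed.

Lemma le_sub_usingle x B : B x <= sub (usingle x) B.
Proof.
apply/le_subP => y; rewrite /usingle; case: asboolP => [->|_].
  by rewrite tensorq1.
by rewrite tensorC; apply/residuumP; apply: le0x.
Qed.

End SubTheory.

(** * Point closures as principal ideals *)

Section IdealCompletion.
Context {d : Order.disp_t} {L : quantaleType d} {X : Type}.
Variable cl : Lclosure L X.
Local Notation c x := (cl (usingle x)).
Local Notation dc := (directed_closed cl).
Local Notation e := (@dc_sub d L X cl).
Implicit Types (U V W : dc) (D : dc -> L).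

Lemma point_closure_refl x : qunit <= c x x.
Proof.
apply: le_trans (Lclosure_ext cl (usingle x) x).
by rewrite /usingle; case: asboolP.
Qed.

(** By monotonicity and idempotence of [cl], [y] belongs to [c x] at most to
    the degree to which [c y] is contained in [c x]. *)
Lemma point_closure_sub x y : c x y <= sub (c y) (c x).
Proof.
apply: le_trans (le_sub_usingle y (c x)) _.
by have := Lclosure_sub cl (usingle y) (c x); rewrite Lclosure_idem.
Qed.

(** Ideals of the preorder are directed closed: in (DC3), take [y] to be [x]. *)
Lemma directed_closed_intro (U : X -> L) :
  qunit <= \bigvee_(x : X) U x ->
  (forall x y, U x ⊗ c x y <= U y) ->
  (forall x y, U x ⊗ U y <= \bigvee_(z : X) (U z ⊗ c z x ⊗ c z y)) ->
  is_directed_closed cl U.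
Proof.
move=> U1 U2 U4; split=> // x; first by apply/le_subP.
by apply: (@bigjoin_ub _ _ _ _ x); apply/le_tensorr/point_closure_refl.
Qed.

Lemma dc_nonempty U : qunit <= \bigvee_(x : X) sval U x.
Proof. by case: U => U []. Qed.

Lemma dc_lower U x y : sval U x ⊗ c x y <= sval U y.
Proof. by case: U => U [_ U2 _ _] /=; move: y; apply/le_subP. Qed.

Lemma dc_directed U x y :
  sval U x ⊗ sval U y <= \bigvee_(z : X) (sval U z ⊗ c z x ⊗ c z y).
Proof. by case: U => U []. Qed.

Lemma principal_closed x : is_directed_closed cl (c x).
Proof.
apply: directed_closed_intro => [|y z|y z].
- by apply: (@bigjoin_ub _ _ _ _ x); apply: point_closure_refl.
- by apply/residuumP; apply: le_trans (point_closure_sub x y) _;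
    apply/residuumP/sub_tensor.
- apply: (@bigjoin_ub _ _ _ _ x); rewrite -tensorA.
  exact/le_tensorl/point_closure_refl.
Qed.

Definition principal x : dc := exist _ (c x) (principal_closed x).

Lemma principal_yoneda x U : e (principal x) U = sval U x.
Proof.
apply/le_anti/andP; split; last by apply/le_subP => y; apply: dc_lower.
apply: le_trans (sub_tensor (c x) (sval U) x).
exact/le_tensorr/point_closure_refl.
Qed.

(** * Directed suprema of directed closed sets *)

Lemma dc_sub_order : is_Lorder e.
Proof.
split=> [U|U V W|U V]; [exact: sub_refl|exact: sub_trans|].
rewrite lexI => /andP[UV VU].
by case: U V UV VU => [U ?] [V ?] UV VU; apply/eq_exist/sub_anti.
Qed.

Definition dc_union D (y : X) : L := \bigvee_(V : dc) (D V ⊗ sval V y).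

Lemma is_Lsup_union D U : sval U = dc_union D -> is_Lsup e D U.
Proof.
move=> UE V; apply/le_anti/andP; split.
- apply/le_bigmeetP => W; apply/residuumP/le_subP => y; rewrite -tensorA.
  apply: le_trans (sub_tensor (sval U) (sval V) y).
  apply: tensor_le2 => //; rewrite UE.
  exact: (@bigjoin_ub _ _ _ _ W).
- apply/le_subP => y; rewrite UE tensorC; apply: bigjoin_tensor_le => W.
  rewrite tensorAC [D W ⊗ _]tensorC.
  apply: le_trans (sub_tensor (sval W) (sval V) y).
  by apply: tensor_le2l; apply/residuumP/bigmeet_lb; exists W.
Qed.

Lemma dc_union_closed D : is_directed e D -> is_directed_closed cl (dc_union D).
Proof.
case=> D1 D2; apply: directed_closed_intro => [|x y|x y].
- apply: le_trans D1 _; apply: bigjoin_le => V.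
  apply: le_trans (le_tensorr _ (dc_nonempty V)) _.
  rewrite tensorC; apply: bigjoin_tensor_le => x; rewrite tensorC.
  by apply: (@bigjoin_ub _ _ _ _ x); apply: (@bigjoin_ub _ _ _ _ V).
- apply: bigjoin_tensor_le => V; apply: (@bigjoin_ub _ _ _ _ V).
  by rewrite -tensorA; apply: tensor_le2 => //; apply: dc_lower.
- apply: bigjoin_tensor2_le => V W; rewrite tensorACA.
  apply: le_trans (tensor_le2l _ (D2 V W)) _.
  apply: bigjoin_tensor_le => Z.
  (* [x] and [y] both move into the common upper bound [Z] of [V] and [W],
     where they are bounded by a single point because [Z] is directed. *)
  rewrite -[D Z ⊗ _ ⊗ _]tensorA -tensorA tensorACA.
  apply: le_trans (tensor_le2 (lexx _) (tensor_le2 (sub_tensor _ _ x)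
    (sub_tensor _ _ y))) _.
  apply: le_trans (tensor_le2 (lexx _) (dc_directed Z x y)) _.
  rewrite tensorC; apply: bigjoin_tensor_le => z; rewrite tensorC.
  apply: (@bigjoin_ub _ _ _ _ z); rewrite !tensorA.
  by do 2!apply: tensor_le2l; apply: (@bigjoin_ub _ _ _ _ Z).
Qed.

Lemma dc_dcpo : is_Ldcpo e.
Proof.
split=> [|D Ddir]; first exact: dc_sub_order.
by exists (exist _ _ (dc_union_closed Ddir)); apply: is_Lsup_union.
Qed.

(** Since suprema are unions, [sub (c x) (sup I) = (sup I) x] is the join over
    [V] of [I V ⊗ V x = I V ⊗ sub (c x) V], and [I] is a lower set. *)
Lemma principal_compact x : is_compact e (principal x).
Proof.
apply: le_bigmeet => _ [I [S [[Idir Ilow] IS ->]]].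
apply/residuumP; rewrite tensor1q principal_yoneda.
rewrite (is_Lsup_unique dc_sub_order IS
  (@is_Lsup_union I (exist _ _ (dc_union_closed Idir)) erefl)) /=.
by apply: bigjoin_le => V; rewrite -principal_yoneda; apply: Ilow.
Qed.

(** * Approximation by principal ideals *)

Definition approx U V : L := \bigvee_(x : X) (sval U x ⊗ e V (principal x)).

Lemma approx_sub U V : approx U V <= e V U.
Proof.
apply: bigjoin_le => x; rewrite -principal_yoneda tensorC.
exact: sub_trans.
Qed.

Lemma approx_lower U : is_lower e (approx U).
Proof.
move=> V W; apply: bigjoin_tensor_le => x; apply: (@bigjoin_ub _ _ _ _ x).
rewrite -tensorA; apply: tensor_le2 => //; rewrite tensorC.
exact: sub_trans.
Qed.

Lemma approx_principal U x : sval U x <= approx U (principal x).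
Proof. by apply: (@bigjoin_ub _ _ _ _ x); apply/le_tensorr/sub_refl. Qed.

(** Directedness of [U] gives one point [z] of [U] whose principal ideal lies
    above the two that bound [V] and [W]. *)
Lemma approx_directed U V W :
  approx U V ⊗ approx U W <=
  \bigvee_(z : X) (sval U z ⊗ e V (principal z) ⊗ e W (principal z)).
Proof.
apply: bigjoin_tensor2_le => x y; rewrite tensorACA.
apply: le_trans (tensor_le2l _ (dc_directed U x y)) _.
apply: bigjoin_tensor_le => z; apply: (@bigjoin_ub _ _ _ _ z).
rewrite -[sval U z ⊗ _ ⊗ _]tensorA -!tensorA; apply: tensor_le2 => //.
rewrite tensorA tensorACA ![c z _ ⊗ _]tensorC.
by apply: tensor_le2;
  (apply: le_trans (tensor_le2 (lexx _) (point_closure_sub _ _)) _;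
   exact: sub_trans).
Qed.

Section Between.
Variables (U : dc) (D : dc -> L).
Hypothesis D_principal : forall x, sval U x <= D (principal x).
Hypothesis D_approx : forall V, D V <= approx U V.

Lemma between_directed : is_directed e D.
Proof.
split=> [|V W].
  apply: le_trans (dc_nonempty U) _; apply: bigjoin_le => x.
  exact: (@bigjoin_ub _ _ _ _ (principal x)).
apply: le_trans (tensor_le2 (D_approx V) (D_approx W)) _.
apply: le_trans (approx_directed U V W) _; apply: bigjoin_le => z.
by apply: (@bigjoin_ub _ _ _ _ (principal z)); do 2!apply: tensor_le2l.
Qed.

Lemma between_sup : is_Lsup e D U.
Proof.
apply: is_Lsup_union; apply/funext => y; apply/le_anti/andP; split.
  apply: (@bigjoin_ub _ _ _ _ (principal y)).
  apply: le_trans (D_principal y) _.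
  exact/le_tensorr/point_closure_refl.
apply: bigjoin_le => V; apply: le_trans (sub_tensor (sval V) (sval U) y).
by apply: tensor_le2l; apply: le_trans (D_approx V) (approx_sub U V).
Qed.

End Between.

(** Compactness of [V] is tested against the ideal [approx U], whose supremum
    is [U]. *)
Lemma compact_below_approx U V : compact_below e U V <= approx U V.
Proof.
rewrite /compact_below; case: asboolP => [Vcompact|_]; last exact: le0x.
rewrite -[leLHS]tensor1q; apply/residuumP.
apply: le_trans Vcompact _; apply: bigmeet_lb; exists (approx U), U.
have [Uprin Uapprox] := (approx_principal U, fun V => lexx (approx U V)).
split=> //; last exact: between_sup.
by split; [exact: between_directed|exact: approx_lower].
Qed.

Lemma principal_compact_below U x : sval U x <= compact_below e U (principal x).
Proof.
rewrite /compact_below; case: asboolP => [_|]; first by rewrite principal_yoneda.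
by case; apply: principal_compact.
Qed.

End IdealCompletion.

Theorem theorem4p4 (d : Order.disp_t) (L : quantaleType d) (X : Type)
    (cl : Lclosure L X) :
  is_algebraic_Ldcpo (@dc_sub d L X cl).
Proof.
split=> [|U]; first exact: dc_dcpo.
have [Uprin Uapprox] := (principal_compact_below U, compact_below_approx U).
by split; [exact: between_directed|exact: between_sup].
Qed.
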